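(* Let $\Phi$ be a Leonard system over $\mathbb F$ of type I, with eigenvalue sequence $\{\theta_i\}_{i=0}^d$, dual eigenvalue sequence $\{\theta^*_i\}_{i=0}^d$, and scalars $q,a,b,c,a^*,b^*,c^*\in\overline{\mathbb F}$ with $q\ne0$, $q^2+q^{-2}=\beta$ ($\beta$ the base of $\Phi$), $\theta_i=a+bq^{2i-d}+cq^{d-2i}$ and $\theta^*_i=a^*+b^*q^{2i-d}+c^*q^{d-2i}$ for $0\le i\le d$. Let $\{\varphi_i\}_{i=1}^d$, $\{\phi_i\}_{i=1}^d$ be the first and second split sequences of $\Phi$, and let $t\in\overline{\mathbb F}$ be such that for $1\le i\le d$ $$\varphi_i=(q^i-q^{-i})(q^{d-i+1}-q^{i-d-1})(t-bb^*q^{2i-d-1}-cc^*q^{d+1-2i}),$$ $$\phi_i=(q^i-q^{-i})(q^{d-i+1}-q^{i-d-1})(t-cb^*q^{2i-d-1}-bc^*q^{d+1-2i}).$$ Let $\hat P$ be the normalized Drinfel'd polynomial of $\Phi$. (i) Assume $bb^*cc^*\ne0$, and let $\psi\in\overline{\mathbb F}$ be a solution of $\psi+bb^*cc^*\psi^{-1}=t$. Then the roots of $\hat P$ are $\psi q^{d+1-2i}+bb^*cc^*\psi^{-1}q^{2i-d-1}$ $(1\le i\le d)$. (ii) Assume $bb^*cc^*=0$. Then the roots of $\hat P$ are $tq^{d+1-2i}$ $(1\le i\le d)$.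
   Context: Let $\mathbb F$ be a field, $\overline{\mathbb F}$ its algebraic closure, $V$ a vector space over $\mathbb F$ of finite positive dimension. A tridiagonal pair on $V$ is an ordered pair of $\mathbb F$-linear maps $A,A^*:V\to V$ ($A^*$ is just a name, not an adjoint) such that: (i) both are diagonalizable; (ii) the eigenspaces of $A$ can be ordered $V_0,\dots,V_d$ with $A^*V_i\subseteq V_{i-1}+V_i+V_{i+1}$ ($0\le i\le d$, $V_{-1}=V_{d+1}=0$); (iii) the eigenspaces of $A^*$ can be ordered $V^*_0,\dots,V^*_\delta$ with $AV^*_i\subseteq V^*_{i-1}+V^*_i+V^*_{i+1}$ ($0\le i\le\delta$, $V^*_{-1}=V^*_{\delta+1}=0$); (iv) no subspace $W\ne 0,V$ satisfies $AW\subseteq W$ and $A^*W\subseteq W$. It is known that $d=\delta$ (the diameter) and $\dim V_i=\dim V^*_i=\dim V_{d-i}$. Orderings as in (ii), (iii) are called standard. The pair is a Leonard pair if all $V_i$, $V_i^*$ have dimension 1. A tridiagonal system over $\mathbb F$ is a sequence $\Phi=(A;\{E_i\}_{i=0}^d;A^*;\{E^*_i\}_{i=0}^d)$ where $A,A^*$ is a tridiagonal pair and, for standard orderings of the eigenspaces, $E_i$ (resp. $E^*_i$) is the projection onto $V_i$ (resp. $V^*_i$) along the sum of the other eigenspaces. $\Phi$ is a Leonard system if $A,A^*$ is a Leonard pair. The eigenvalue sequence $\{\theta_i\}$ (dual eigenvalue sequence $\{\theta^*_i\}$) consists of the eigenvalues of $A$ on $E_iV$ (of $A^*$ on $E^*_iV$).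 For $\dim E^*_0V=1$, $E^*_0V$ is known to be invariant under $(A^*-\theta^*_1I)\cdots(A^*-\theta^*_iI)(A-\theta_{i-1}I)\cdots(A-\theta_0I)$ for $0\le i\le d$; $\zeta_i$ denotes the corresponding eigenvalue, and $\{\zeta_i\}_{i=0}^d$ is the split sequence of $\Phi$ ($\zeta_0=1$). Put $\Phi^\Downarrow=(A;\{E_{d-i}\}_{i=0}^d;A^*;\{E^*_i\}_{i=0}^d)$. For a Leonard system the split sequences of $\Phi$ and $\Phi^\Downarrow$ are known to have nonzero entries, and the first split sequence $\{\varphi_i\}_{i=1}^d$ (second split sequence $\{\phi_i\}_{i=1}^d$) is determined by the requirement that $\{\varphi_1\cdots\varphi_i\}_{i=0}^d$ (resp. $\{\phi_1\cdots\phi_i\}_{i=0}^d$) is the split sequence of $\Phi$ (resp. $\Phi^\Downarrow$). Base $\beta\in\mathbb F$: if $d\ge3$, the expressions $\frac{\theta_{i-2}-\theta_{i+1}}{\theta_{i-1}-\theta_i}$, $\frac{\theta^*_{i-2}-\theta^*_{i+1}}{\theta^*_{i-1}-\theta^*_i}$ are known to be equal and independent of $i$ for $2\le i\le d-1$, and $\beta+1$ is their common value; if $d\le2$, $\beta$ is any fixed nonzero scalar in $\mathbb F$. Type I means $\beta\ne2$ and $\beta\neq-2$. For type I it is known that scalars $a,b,c,a^*,b^*,c^*$ as in the claim exist for any $q$ with $q^2+q^{-2}=\beta$, that $q^{2i}\ne1$ for $1\le i\le d$, and that (for a Leonard system) a scalar $t$ as in the claim exists. Normalized Drinfel'd polynomial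 (type I): $\hat P=\sum_{i=0}^d\zeta_i\,\hat p_{i+1}\hat p_{i+2}\cdots\hat p_d$, a polynomial in $\lambda$ with coefficients in $\overline{\mathbb F}$, where $\hat p_i=(q^i-q^{-i})^2(bb^*q^{2i-2d}+cc^*q^{2d-2i}-\lambda)$ for $1\le i\le d$. *)

(* Defs.v *)
From mathcomp Require Import all_boot all_algebra.

Set Implicit Arguments.
Unset Strict Implicit.
Unset Printing Implicit Defensive.

Import GRing.Theory.
Local Open Scope ring_scope.

Section TridiagonalPairs.

Variables (F : fieldType) (V : vectType F).
Implicit Types (A As : 'End(V)) (W : {vspace V}).

Definition is_eigenspace A W : Prop :=
  exists2 a : F, passmx.leigenvalue A a & W = passmx.leigenspace A a.

Definition is_diagonalizable A : Prop :=
  exists2 X : seq V, basis_of fullv X &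
    forall v, v \in X -> exists a : F, A v = a *: v.

Definition eigenspace_ordering A (d : nat) (Vs : 'I_d.+1 -> {vspace V}) : Prop :=
  injective Vs /\ forall W, is_eigenspace A W <-> exists i, W = Vs i.

(* The sum over the indices j with |i - j| <= 1 is V_(i-1) + V_i + V_(i+1)
   with V_(-1) = V_(d+1) = 0. *)
Definition standard_ordering A As (d : nat) (Vs : 'I_d.+1 -> {vspace V}) : Prop :=
  eigenspace_ordering A Vs /\
  forall i : 'I_d.+1,
    (As @: Vs i <= \sum_(j < d.+1 | (i <= j.+1)%N && (j <= i.+1)%N) Vs j)%VS.

Definition tridiagonal_pair A As : Prop :=
  [/\ is_diagonalizable A /\ is_diagonalizable As,
      exists (d : nat) (Vs : 'I_d.+1 -> {vspace V}), standard_ordering A As Vs,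
      exists (delta : nat) (Vss : 'I_delta.+1 -> {vspace V}),
        standard_ordering As A Vss
    & forall W, (A @: W <= W)%VS -> (As @: W <= W)%VS ->
        W = 0%VS \/ W = fullv].

Definition leonard_pair A As : Prop :=
  tridiagonal_pair A As /\
  forall W, is_eigenspace A W \/ is_eigenspace As W -> \dim W = 1%N.

(* The bare data (A; {E_i}; A^*; {E^*_i}), i = 0..d; stars are rendered by a
   trailing s. *)
Record td_data (d : nat) := TDData {
  td_A : 'End(V);
  td_E : 'I_d.+1 -> 'End(V);
  td_As : 'End(V);
  td_Es : 'I_d.+1 -> 'End(V)
}.

Definition eigenspace_projections (d : nat) (Vs : 'I_d.+1 -> {vspace V})
    (E : 'I_d.+1 -> 'End(V)) : Prop :=
  forall i, E i = daddv_pi (Vs i) (\sum_(j < d.+1 | j != i) Vs j)%VS.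

Definition tridiagonal_system (d : nat) (Phi : td_data d) : Prop :=
  tridiagonal_pair (td_A Phi) (td_As Phi) /\
  exists Vs Vss : 'I_d.+1 -> {vspace V},
    [/\ standard_ordering (td_A Phi) (td_As Phi) Vs,
        standard_ordering (td_As Phi) (td_A Phi) Vss,
        eigenspace_projections Vs (td_E Phi)
      & eigenspace_projections Vss (td_Es Phi)].

Definition leonard_system (d : nat) (Phi : td_data d) : Prop :=
  tridiagonal_system Phi /\ leonard_pair (td_A Phi) (td_As Phi).

(* Phi^\Downarrow *)
Definition td_Down (d : nat) (Phi : td_data d) : td_data d :=
  TDData (td_A Phi) (fun i => td_E Phi (rev_ord i)) (td_As Phi) (td_Es Phi).

(* Scalar sequences are functions on nat; only their values at indices up to d
   matter (from 1 for the first and second split sequences). *)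
Definition eigenvalue_seq (d : nat) (Phi : td_data d) (theta : nat -> F) : Prop :=
  forall (i : 'I_d.+1) v, v \in limg (td_E Phi i) -> td_A Phi v = theta i *: v.

Definition dual_eigenvalue_seq (d : nat) (Phi : td_data d)
    (thetas : nat -> F) : Prop :=
  forall (i : 'I_d.+1) v, v \in limg (td_Es Phi i) -> td_As Phi v = thetas i *: v.

(* (A^* - theta^*_1) ... (A^* - theta^*_i) (A - theta_(i-1)) ... (A - theta_0) *)
Definition split_op (d : nat) (Phi : td_data d) (theta thetas : nat -> F)
    (i : nat) : 'End(V) :=
  ((\big[@comp_lfun F V V V / \1]_(k <- iota 1 i)
       (td_As Phi - thetas k *: \1%VF)%R) \o
   (\big[@comp_lfun F V V V / \1]_(k <- rev (iota 0 i))
       (td_A Phi - theta k *: \1%VF)%R))%VF.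

Definition split_seq (d : nat) (Phi : td_data d) (zeta : nat -> F) : Prop :=
  exists theta thetas : nat -> F,
    [/\ eigenvalue_seq Phi theta, dual_eigenvalue_seq Phi thetas
      & forall i, (i <= d)%N -> forall v, v \in limg (td_Es Phi ord0) ->
          split_op Phi theta thetas i v = zeta i *: v].

Definition first_split_seq (d : nat) (Phi : td_data d) (varphi : nat -> F) : Prop :=
  split_seq Phi (fun i => \prod_(1 <= j < i.+1) varphi j).

Definition second_split_seq (d : nat) (Phi : td_data d) (phi : nat -> F) : Prop :=
  split_seq (td_Down Phi) (fun i => \prod_(1 <= j < i.+1) phi j).

Definition is_base (d : nat) (Phi : td_data d) (beta : F) : Prop :=
  if (3 <= d)%N then
    exists theta thetas : nat -> F,
      [/\ eigenvalue_seq Phi theta, dual_eigenvalue_seq Phi thetas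
        & forall i, (2 <= i <= d.-1)%N ->
            (theta (i - 2)%N - theta i.+1) / (theta i.-1 - theta i) = beta + 1 /\
            (thetas (i - 2)%N - thetas i.+1) / (thetas i.-1 - thetas i) = beta + 1]
  else beta != 0.

Definition type_I (beta : F) : Prop := beta != 2 /\ beta != - 2.

End TridiagonalPairs.

Section Drinfeld.

Variable K : fieldType.

Definition drinfeld_factor (d : nat) (q b c bs cs : K) (i : nat) : {poly K} :=
  (q ^+ i - q ^- i) ^+ 2 *:
    ((b * bs * q ^ (2 * i%:Z - 2 * d%:Z) + c * cs * q ^ (2 * d%:Z - 2 * i%:Z))%:P
     - 'X).

Definition normalized_drinfeld (d : nat) (q b c bs cs : K) (zeta : nat -> K) :
    {poly K} :=
  \sum_(0 <= i < d.+1)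
    zeta i *: \prod_(i.+1 <= j < d.+1) drinfeld_factor d q b c bs cs j.

(* The roots of P, counted with multiplicity, are the entries of rs. *)
Definition roots_are (P : {poly K}) (rs : seq K) : Prop :=
  P != 0 /\ P = lead_coef P *: \prod_(r <- rs) ('X - r%:P).

End Drinfeld.

Definition is_algebraic_closure (F : fieldType) (K : closedFieldType)
    (iota : {rmorphism F -> K}) : Prop :=
  forall x : K, algebraicOver iota x.

(* Main.v *)
Require Import Defs.
From mathcomp Require Import all_boot all_algebra.
From mathcomp Require Import ring zify.

Set Implicit Arguments.
Unset Strict Implicit.
Unset Printing Implicit Defensive.

Import GRing.Theory.
Local Open Scope ring_scope.

(** The split sequence is determined by the system, so zeta_i is the product
    varphi_1 ... varphi_i, and the closed form of the varphi_i turns the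
    Drinfel'd polynomial into an explicit sum in q, x = b b*, y = c c* and t.
    The theorem is then a terminating q-Saalschuetz summation.

    Both cases write t = psi + psi' with psi psi' = x y (psi' = x y / psi in
    the first, psi = t and psi' = 0 in the second) and claim the roots
    psi q^(d+1-2j) + psi' q^(2j-d-1).  The condition psi psi' = x y says that
    the matrix with rows (psi, x) and (y, psi') has rank at most one, so
    psi = p r, psi' = p' r', x = p r', y = p' r for some p, p', r, r'
    ([rank_one_factorization]).  In these parameters the factor of varphi_j
    that involves t splits:
      t - x q^m - y q^(-m) = (p - p' q^(-m)) (r - r' q^m),
    which treats both cases at once and needs no division by psi.

    Up to the scalar prod_j (q^j - q^(-j))^2, the polynomial is a combination
    of the Newton products prod_(k < n) (x q^(-2k) + y q^(2k) - X), whose nodes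
    do not depend on d; [q_saalschutz] evaluates it by induction on d.  The
    product of the first d factors root_j - X for diameter d + 1 is the product
    for diameter d with r and p' replaced by r q and p' / q, a change that
    preserves x and y.  Multiplying by the last factor e - X shifts the Newton
    products, since e - X = (node - X) + (e - node), and the coefficients
    satisfy the resulting recurrence ([saalschutz_coef_pascal]).

    The scalar is nonzero because q^(2j) = 1 would give theta_j = theta_0,
    while the eigenvalues are distinct; hence the roots are as claimed, with
    multiplicity. *)

(** * Eigenvalues and split sequences of a tridiagonal system *)

Section Systems.
Variables (F : fieldType) (V : vectType F).
Implicit Type A : 'End(V).

Lemma prod_sub_scale_eigenvector A (mu : F) v (s : seq F) :
  A v = mu *: v ->
  (\big[@comp_lfun F V V V / \1%VF]_(x <- s) (A - x *: \1%VF)) v =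
    (\prod_(x <- s) (mu - x)) *: v.
Proof.
move=> Av; elim: s => [|x s IHs]; first by rewrite !big_nil id_lfunE scale1r.
rewrite !big_cons comp_lfunE IHs linearZ /= !lfunE /= !lfunE /= !lfunE /= Av.
by rewrite id_lfunE -scalerBl scalerA mulrC.
Qed.

Lemma memv_leigenspace A (mu : F) v :
  (v \in passmx.leigenspace A mu) = (A v == mu *: v).
Proof.
by rewrite memv_ker !lfunE /= !lfunE /= !lfunE /= id_lfunE subr_eq0.
Qed.

(** The product of the [A - th j] over [j != i] kills the sum of the other
    eigenspaces but acts on the [i]th one by a nonzero scalar. *)
Lemma leigenspace_cap_sum A n (th : 'I_n -> F) (i : 'I_n) :
  injective th ->
  (passmx.leigenspace A (th i)
     :&: \sum_(j < n | j != i) passmx.leigenspace A (th j) = 0)%VS.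
Proof.
move=> th_inj; apply/eqP; rewrite -subv0; apply/subvP=> v /memv_capP[].
rewrite memv_leigenspace => /eqP Av /memv_sumP[us us_eig v_sum].
pose s := [seq th j | j <- enum 'I_n & j != i].
pose f : 'End(V) :=
  \big[@comp_lfun F V V V / \1%VF]_(x <- s) (A - x *: \1%VF).
have fv0 : f v = 0.
  rewrite v_sum linear_sum big1 // => j ji.
  have /eqP Auj : A (us j) == th j *: us j by rewrite -memv_leigenspace us_eig.
  apply: etrans (prod_sub_scale_eigenvector s Auj) _.
  suff -> : \prod_(x <- s) (th j - x) = 0 by rewrite scale0r.
  rewrite big_map; apply/eqP; rewrite prodf_seq_eq0; apply/hasP.
  exists j; first by rewrite mem_filter ji mem_enum.
  by rewrite /= subrr.
move: fv0; rewrite /f (prod_sub_scale_eigenvector _ Av) => /eqP.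
rewrite scaler_eq0 memv0 => /orP[|//].
rewrite big_map prodf_seq_eq0 => /hasP[j].
by rewrite mem_filter /= subr_eq0 (inj_eq th_inj) => /andP[/negPf ji _] /eqP eij;
   rewrite eij eqxx in ji.
Qed.

(** Directness of the eigenspaces makes each [E i] nonzero, with image in the
    [i]th eigenspace; so the image pins down the [i]th eigenvalue. *)
Lemma standard_projections_eigenvalues d A As (Vs : 'I_d.+1 -> {vspace V}) E :
  standard_ordering A As Vs -> eigenspace_projections Vs E ->
  (forall i, exists2 v, v != 0 & v \in limg (E i)) /\
  exists2 th : 'I_d.+1 -> F, injective th
    & forall theta : nat -> F,
        (forall (i : 'I_d.+1) v, v \in limg (E i) -> A v = theta i *: v) ->
        forall i : 'I_d.+1, theta i = th i.
Proof.
move=> [[Vs_inj Vs_eig] _] hE.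
have /fin_all_exists[th Vs_th] : forall i, exists x,
    passmx.leigenvalue A x /\ Vs i = passmx.leigenspace A x.
  by move=> i; have /(Vs_eig _)[x] : exists j, Vs i = Vs j; [exists i | exists x].
have th_inj : injective th.
  by move=> i j eij; apply: Vs_inj; rewrite (Vs_th i).2 (Vs_th j).2 eij.
have th_eig i : exists v, [/\ v != 0, v \in limg (E i) & A v = th i *: v].
  have [nz eVi] := Vs_th i; have vi := memv_pick (Vs i).
  exists (vpick (Vs i)); split.
  - by rewrite vpick0 eVi.
  - have cap0 : (Vs i :&: \sum_(j < d.+1 | j != i) Vs j = 0)%VS.
      rewrite eVi; under eq_bigr do rewrite (Vs_th _).2.
      exact: leigenspace_cap_sum.
    by rewrite hE -(daddv_pi_id cap0 vi) memv_img ?memvf.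
  - by apply/eqP; rewrite -memv_leigenspace -eVi.
split=> [i|]; first by have [v [v0 vE _]] := th_eig i; exists v.
exists th => // theta htheta i; have [v [v0 vE Av]] := th_eig i.
move: (htheta i v vE); rewrite Av => /eqP.
by rewrite -subr_eq0 -scalerBl scaler_eq0 (negPf v0) orbF subr_eq0 => /eqP.
Qed.

Section System.

Variables (d : nat) (Phi : td_data V d).
Hypothesis hPhi : tridiagonal_system Phi.

Lemma eigenvalue_seq_inj theta i j :
  eigenvalue_seq Phi theta -> (i <= d)%N -> (j <= d)%N ->
  theta i = theta j -> i = j.
Proof.
case: hPhi => _ [Vs [Vss [hVs _ hE _]]] htheta le_id le_jd.
have [_ [th th_inj thE]] := standard_projections_eigenvalues hVs hE.
have [Ei Ej] := (thE _ htheta (Ordinal (le_id : i < d.+1)%N),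
                 thE _ htheta (Ordinal (le_jd : j < d.+1)%N)).
by rewrite /= in Ei Ej; rewrite Ei Ej => /th_inj[].
Qed.

Lemma split_seq_unique zeta zeta' i :
  split_seq Phi zeta -> split_seq Phi zeta' -> (i <= d)%N -> zeta i = zeta' i.
Proof.
move=> [th1 [ths1 [hth1 hths1 z1]]] [th2 [ths2 [hth2 hths2 z2]]] le_id.
case: hPhi => _ [Vs [Vss [hVs hVss hE hEs]]].
have [_ [th _ thE]] := standard_projections_eigenvalues hVs hE.
have [Es_nz [ths _ thsE]] := standard_projections_eigenvalues hVss hEs.
have eth j : (j <= d)%N -> th1 j = th2 j.
  by move=> le_jd; rewrite (thE _ hth1 (Ordinal (le_jd : j < d.+1)%N))
                           (thE _ hth2 (Ordinal (le_jd : j < d.+1)%N)).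
have eths j : (j <= d)%N -> ths1 j = ths2 j.
  by move=> le_jd; rewrite (thsE _ hths1 (Ordinal (le_jd : j < d.+1)%N))
                           (thsE _ hths2 (Ordinal (le_jd : j < d.+1)%N)).
have [v v0 vE] := Es_nz ord0.
have eop : split_op Phi th1 ths1 i = split_op Phi th2 ths2 i.
  congr (_ \o _)%VF; apply: eq_big_seq => j.
    by rewrite mem_iota add1n ltnS => /andP[_ ji]; rewrite eths // (leq_trans ji).
  rewrite mem_rev mem_iota add0n => /andP[_ ji].
  by rewrite eth // (leq_trans (ltnW ji)).
have /eqP := z2 i le_id v vE; rewrite -eop (z1 i le_id v vE).
by rewrite -subr_eq0 -scalerBl scaler_eq0 (negPf v0) orbF subr_eq0 => /eqP.
Qed.

End System.

End Systems.

(** * The q-Saalschuetz summation *)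

(** The matrix with rows (u, x) and (y, v) has determinant zero, so it is a
    column (p, p') times a row (r, r'): if [u != 0] the second row is [y / u]
    times the first, and if [u = 0] then its first row or column vanishes. *)
Lemma rank_one_factorization (K : fieldType) (x y u v : K) :
  u * v = x * y ->
  exists p p' r r' : K, [/\ p * r = u, p' * r' = v, p * r' = x & p' * r = y].
Proof.
move=> e; have [u0|u0] := eqVneq u 0; last first.
  exists 1, (y / u), u, x; split; rewrite ?mul1r //; last by field.
  by apply: (mulfI u0); rewrite e; field.
have /eqP : x * y = 0 by rewrite -e u0 mul0r.
rewrite mulf_eq0 => /orP[]/eqP z.
  by exists 0, 1, y, v; rewrite u0 z !mul0r !mul1r.
by exists x, v, 0, 1; rewrite u0 z !mulr0 !mulr1.
Qed.

Section QSaalschutz.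
Variables (K : fieldType) (q : K).
Hypothesis q0 : q != 0.

Definition qint (n : int) : K := q ^ n - q ^ - n.

(** The products over [j] from 1 to [i] of the ratios of q-integers are the
    symmetric Gaussian binomials; those of the other two factors are q-shifted
    factorials. *)
Definition saalschutz_ratio d (p p' r r' : K) (j : nat) : K :=
  qint (d%:Z + 1 - j%:Z) / qint j
  * ((p - p' * q ^ (d%:Z + 1 - 2 * j%:Z)) * (r - r' * q ^ (2 * j%:Z - d%:Z - 1))).

Definition saalschutz_coef d p p' r r' (i : nat) : K :=
  \prod_(1 <= j < i.+1) saalschutz_ratio d p p' r r' j.

Definition newton_node (x y : K) (k : nat) : K :=
  x * q ^ (- (2 * k%:Z)) + y * q ^ (2 * k%:Z).

Definition newton_prod (x y : K) (n : nat) : {poly K} :=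
  \prod_(0 <= k < n) ((newton_node x y k)%:P - 'X).

Lemma saalschutz_coefS d p p' r r' i :
  saalschutz_coef d p p' r r' i.+1 =
  saalschutz_coef d p p' r r' i * saalschutz_ratio d p p' r r' i.+1.
Proof. by rewrite /saalschutz_coef big_nat_recr. Qed.

Lemma saalschutz_coef0 d p p' r r' : saalschutz_coef d p p' r r' 0 = 1.
Proof. by rewrite /saalschutz_coef big_nil. Qed.

(** The factors [p - p' * q ^ _] of the shifted parameters are, up to a
    power of q, those of diameter [d.+1] with index moved by one: this
    cancels all but the end factors of the two products. *)
Lemma saalschutz_coef_shift d p p' r r' i :
  (forall j, (1 <= j <= i.+1)%N -> qint j != 0) ->
  saalschutz_coef d.+1 p p' r r' i.+1 * qint i.+1 * q ^ i =
  saalschutz_coef d p (p' / q) (r * q) r' i * qint d.+1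
    * ((p - p' * q ^ d) * (r - r' * q ^ (2 * i%:Z - d%:Z))).
Proof.
elim: i => [|i IHi] nz.
  have n1 := nz 1%N isT.
  rewrite !saalschutz_coefS !saalschutz_coef0 /saalschutz_ratio.
  have -> : d.+1%:Z + 1 - 1%:Z = d.+1%:Z by lia.
  have -> : d.+1%:Z + 1 - 2 * 1%:Z = d%:Z by lia.
  have -> : 2 * 1%:Z - d.+1%:Z - 1 = 2 * 0%:Z - d%:Z by lia.
  rewrite expr0z; field. exact: n1.
have n1 : qint i.+1 != 0 by rewrite nz /=.
have n2 : qint i.+2 != 0 by rewrite nz /=.
have nz' j : (1 <= j <= i.+1)%N -> qint j != 0 by move=> h; apply: nz; lia.
have {IHi nz'} IH := IHi nz'.
rewrite [in RHS]saalschutz_coefS.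
apply: (@mulIf _ (q^-1)); first by rewrite invr_eq0.
transitivity (saalschutz_coef d.+1 p p' r r' i.+1 * qint i.+1 * q ^ i
   * (saalschutz_ratio d.+1 p p' r r' i.+2 * qint i.+2 / qint i.+1)).
  rewrite [in LHS]saalschutz_coefS exprSz; field; rewrite q0 n1 //; lia.
rewrite IH /saalschutz_ratio.
have -> : d.+1%:Z + 1 - i.+2%:Z = d%:Z + 1 - i.+1%:Z by lia.
have -> : d.+1%:Z + 1 - 2 * i.+2%:Z = d%:Z + 1 - 2 * i.+1%:Z + (- 1) by lia.
have -> : 2 * i.+2%:Z - d.+1%:Z - 1 = 2 * i.+1%:Z - d%:Z by lia.
have -> : 2 * i.+1%:Z - d%:Z - 1 = 2 * i%:Z - d%:Z + 1 by lia.
have -> : 2 * i.+1%:Z - d%:Z = 2 * i%:Z - d%:Z + 2 by lia.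
rewrite !expfzDr // exprN1 expr1z.
field; rewrite q0 n1 ?n2 //.
Qed.

(** The Pascal-type recurrence matching the expansion of the last linear factor
    [e - 'X], with [e = p r q^(-d) + p' r' q^d], around the node of index
    [d - i].  By [saalschutz_coef_shift] all three terms are multiples of the
    same coefficient, so it reduces to a rational identity in [q^d], [q^i]. *)
Lemma saalschutz_coef_pascal d p p' r r' i :
  (forall j, (1 <= j <= i.+1)%N -> qint j != 0) ->
  saalschutz_coef d.+1 p p' r r' i.+1 =
  saalschutz_coef d p (p' / q) (r * q) r' i.+1 +
  saalschutz_coef d p (p' / q) (r * q) r' i *
    (p * r * q ^ (- d%:Z) + p' * r' * q ^ d
     - (p * r' * q ^ (2 * i%:Z - 2 * d%:Z) + p' * r * q ^ (2 * d%:Z - 2 * i%:Z))).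
Proof.
move=> nz; have n1 : qint i.+1 != 0 by rewrite nz //=.
have e := saalschutz_coef_shift d p p' r r' nz.
apply: (@mulIf _ (qint i.+1 * q ^ i)); first by rewrite mulf_neq0 ?expfz_neq0.
rewrite mulrA e saalschutz_coefS /saalschutz_ratio.
apply: (@mulIf _ (qint i.+1)) => //.
have -> : d%:Z + 1 - i.+1%:Z = d%:Z - i%:Z by lia.
have -> : d%:Z + 1 - 2 * i.+1%:Z = d%:Z - i%:Z - i%:Z - 1 by lia.
have -> : 2 * i.+1%:Z - d%:Z - 1 = i%:Z + i%:Z - d%:Z + 1 by lia.
have -> : 2 * i%:Z - 2 * d%:Z = i%:Z + i%:Z - d%:Z - d%:Z by lia.
have -> : 2 * i%:Z - d%:Z = i%:Z + i%:Z - d%:Z by lia.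
have -> : 2 * d%:Z - 2 * i%:Z = d%:Z + d%:Z - i%:Z - i%:Z by lia.
move: n1; rewrite /qint.
have -> : (d.+1 : int) = d%:Z + 1 by lia.
have -> : (i.+1 : int) = i%:Z + 1 by lia.
rewrite !opprD !opprK !expfzDr // !exprN1 !expr1z -![q ^ - _%:Z]invr_expz.
have : q ^ d != 0 by rewrite expfz_neq0.
have : q ^ i != 0 by rewrite expfz_neq0.
move: (q ^ d) (q ^ i) => Q I I0 Q0 n1.
field; rewrite q0 I0 Q0 /=.
apply: contraNneq n1 => h.
have -> : I * q - I^-1 / q = (I * q * (I * q) - 1) / (I * q).
  by field; rewrite q0.
by rewrite h mul0r.
Qed.

Lemma newton_prodS x y n :
  newton_prod x y n.+1 = newton_prod x y n * ((newton_node x y n)%:P - 'X).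
Proof. by rewrite /newton_prod big_nat_recr. Qed.

(** The induction absorbs one root at a time; the shift of the exponents of the
    remaining roots is compensated by [r := r * q], [p' := p' / q], which
    leaves the Newton nodes unchanged. *)
Lemma q_saalschutz d p p' r r' :
  (forall j, (1 <= j <= d)%N -> qint j != 0) ->
  \prod_(1 <= j < d.+1)
     ((p * r * q ^ (d%:Z + 1 - 2 * j%:Z)
       + p' * r' * q ^ (2 * j%:Z - d%:Z - 1))%:P - 'X) =
  \sum_(0 <= i < d.+1)
     saalschutz_coef d p p' r r' i *: newton_prod (p * r') (p' * r) (d - i).
Proof.
elim: d p' r => [|d IHd] p' r nz.
  by rewrite big_nil big_nat1 saalschutz_coef0 /newton_prod big_nil scale1r.
have nz' j : (1 <= j <= d)%N -> qint j != 0 by move=> h; apply: nz; lia.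
rewrite big_nat_recr //=.
have -> : \prod_(1 <= j < d.+1)
     ((p * r * q ^ (d.+1%:Z + 1 - 2 * j%:Z)
       + p' * r' * q ^ (2 * j%:Z - d.+1%:Z - 1))%:P - 'X) =
   \prod_(1 <= j < d.+1)
     ((p * (r * q) * q ^ (d%:Z + 1 - 2 * j%:Z)
       + (p' / q) * r' * q ^ (2 * j%:Z - d%:Z - 1))%:P - 'X).
  apply: eq_bigr => j _; congr (_%:P - _).
  have -> : d.+1%:Z + 1 - 2 * j%:Z = d%:Z + 1 - 2 * j%:Z + 1 by lia.
  have -> : 2 * j%:Z - d.+1%:Z - 1 = 2 * j%:Z - d%:Z - 1 + (- 1) by lia.
  by rewrite !(expfzDr _ 1) // !(expfzDr _ (- 1)) // exprN1 expr1z; field.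
rewrite {}IHd // mulr_suml.
have -> : p' / q * (r * q) = p' * r by field.
have -> : d.+1%:Z + 1 - 2 * d.+1%:Z = - d%:Z by lia.
have -> : 2 * d.+1%:Z - d.+1%:Z - 1 = d%:Z by lia.
set x := p * r'; set y := p' * r; set e := p * r * _ + _.
set T := saalschutz_coef d p (p' / q) (r * q) r'.
have step i : (i <= d)%N ->
    T i *: newton_prod x y (d - i) * (e%:P - 'X) =
    T i *: newton_prod x y (d.+1 - i)
    + (T i * (e - newton_node x y (d - i))) *: newton_prod x y (d - i).
  move=> le_id; rewrite subSn // newton_prodS -!mul_polyC !rmorphM rmorphB /=.
  ring.
have -> : \sum_(0 <= i < d.+1) T i *: newton_prod x y (d - i) * (e%:P - 'X) =
  \sum_(0 <= i < d.+1) (T i *: newton_prod x y (d.+1 - i)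
    + (T i * (e - newton_node x y (d - i))) *: newton_prod x y (d - i)).
  by apply: eq_big_nat => i /andP[_ le_id]; rewrite -step.
rewrite big_split /= [X in X + _]big_nat_recl // [RHS]big_nat_recl //.
rewrite {1}/T !saalschutz_coef0 -addrA; congr (_ + _).
(* The factor j = d + 1 of this coefficient contains the q-integer of 0. *)
have Td : T d.+1 = 0.
  rewrite /T saalschutz_coefS /saalschutz_ratio.
  have -> : d%:Z + 1 - d.+1%:Z = 0 by lia.
  by rewrite /qint oppr0 subrr !mul0r mulr0.
rewrite -[X in X + _]addr0.
rewrite -[X in _ + X + _](scale0r (newton_prod x y (d.+1 - d.+1))).
rewrite -Td -(big_nat_recr d 0 (fun i => T i.+1 *: newton_prod x y (d.+1 - i.+1))) //=.
rewrite -big_split; apply: eq_big_nat => i /andP[_ le_id] /=.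
rewrite subSS -scalerDl saalschutz_coef_pascal; last by move=> j h; apply: nz; lia.
congr ((_ + _ * (_ - _)) *: _); rewrite /newton_node; congr (_ * q ^ _ + _ * q ^ _); lia.
Qed.

End QSaalschutz.

(** * Roots of the Drinfel'd polynomial *)

Lemma roots_are_scale_prod (K : fieldType) (P : {poly K}) (C : K) (rs : seq K) :
  C != 0 -> P = C *: \prod_(x <- rs) (x%:P - 'X) -> roots_are P rs.
Proof.
move=> C0 defP.
have {}defP : P = (C * (-1) ^+ size rs) *: \prod_(x <- rs) ('X - x%:P).
  rewrite defP -scalerA; congr (_ *: _); clear defP.
  elim: rs => [|x rs IHrs]; first by rewrite !big_nil scale1r.
  by rewrite !big_cons IHrs exprS mulN1r scaleNr -opprB mulNr scalerAr.
have C'0 : C * (-1) ^+ size rs != 0 by rewrite mulf_neq0 ?signr_eq0.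
have lcP : lead_coef P = C * (-1) ^+ size rs.
  by rewrite defP lead_coefZ (monicP (monic_prod_XsubC _ _ _)) mulr1.
by split; [rewrite -lead_coef_eq0 lcP | rewrite lcP].
Qed.

(** Dividing the [i]th term by the common scalar leaves the coefficient
    [saalschutz_coef], and reversing the order of its remaining factors turns
    them into a Newton product. *)
Lemma normalized_drinfeldE (K : fieldType) (q : K) d (b c bs cs p p' r r' : K)
    (zeta : nat -> K) :
  q != 0 -> (forall j, (1 <= j <= d)%N -> qint q j != 0) ->
  b * bs = p * r' -> c * cs = p' * r ->
  (forall i, (i <= d)%N -> zeta i = \prod_(1 <= j < i.+1)
     (qint q j * qint q (d%:Z + 1 - j%:Z)
      * (p * r + p' * r' - b * bs * q ^ (2 * j%:Z - d%:Z - 1)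
           - c * cs * q ^ (d%:Z + 1 - 2 * j%:Z)))) ->
  normalized_drinfeld d q b c bs cs zeta =
  (\prod_(1 <= j < d.+1) qint q j ^+ 2) *:
    \prod_(1 <= j < d.+1)
      ((p * r * q ^ (d%:Z + 1 - 2 * j%:Z)
        + p' * r' * q ^ (2 * j%:Z - d%:Z - 1))%:P - 'X).
Proof.
move=> q0 nz ex ey zetaE.
rewrite q_saalschutz // scaler_sumr; apply: eq_big_nat => i /andP[_ le_id].
have -> : \prod_(i.+1 <= j < d.+1) drinfeld_factor d q b c bs cs j =
    (\prod_(i.+1 <= j < d.+1) qint q j ^+ 2) *:
      newton_prod q (p * r') (p' * r) (d - i).
  rewrite /drinfeld_factor scaler_prod; congr (_ *: _).
    by apply: eq_bigr => j _; rewrite /qint exprnN.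
  rewrite big_nat_rev /= /newton_prod -{1}[i.+1]add0n big_addn subSS.
  apply: eq_big_nat => k /andP[_ lt_k].
  rewrite ex ey /newton_node; congr ((_ * q ^ _ + _ * q ^ _)%:P - _); lia.
rewrite !scalerA; congr (_ *: _).
rewrite zetaE // [X in _ = X * _](big_cat_nat _ (n := i.+1)) //=.
rewrite [RHS]mulrAC; congr (_ * _).
rewrite /saalschutz_coef -big_split /=; apply: eq_big_nat => j /andP[j1 ji].
have n0 : qint q j != 0 by apply: nz; lia.
have qm m : q ^ m * q ^ (- m) = 1 by rewrite -expfzDr // subrr.
rewrite /saalschutz_ratio ex ey.
have -> : 2 * j%:Z - d%:Z - 1 = - (d%:Z + 1 - 2 * j%:Z) by lia.
have := qm (d%:Z + 1 - 2 * j%:Z).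
move: (q ^ (d%:Z + 1 - _)) (q ^ (- (d%:Z + 1 - _))) => m m' em.
have -> : p * r + p' * r' - p * r' * m' - p' * r * m =
    (p - p' * m) * (r - r' * m').
  by rewrite -[p' * r' in LHS]mulr1 -em; ring.
by field.
Qed.

Theorem proposition9p9
  (F : fieldType) (K : closedFieldType) (emb : {rmorphism F -> K})
  (hK : is_algebraic_closure emb)
  (V : vectType F) (hV : (0 < \dim {:V})%N)
  (d : nat) (Phi : td_data V d) (hPhi : leonard_system Phi)
  (beta : F) (hbeta : is_base Phi beta) (htype : type_I beta)
  (theta thetas : nat -> F)
  (htheta : eigenvalue_seq Phi theta) (hthetas : dual_eigenvalue_seq Phi thetas)
  (q a b c as_ bs cs : K) (hq0 : q != 0)
  (hq : q ^+ 2 + q ^- 2 = emb beta)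
  (hthetaE : forall i, (i <= d)%N ->
     emb (theta i) =
       a + b * q ^ (2 * i%:Z - d%:Z) + c * q ^ (d%:Z - 2 * i%:Z))
  (hthetasE : forall i, (i <= d)%N ->
     emb (thetas i) =
       as_ + bs * q ^ (2 * i%:Z - d%:Z) + cs * q ^ (d%:Z - 2 * i%:Z))
  (varphi phi : nat -> F)
  (hvarphi : first_split_seq Phi varphi) (hphi : second_split_seq Phi phi)
  (t : K)
  (hvarphiE : forall i, (1 <= i <= d)%N ->
     emb (varphi i) =
       (q ^+ i - q ^- i)
       * (q ^ (d%:Z - i%:Z + 1) - q ^ (i%:Z - d%:Z - 1))
       * (t - b * bs * q ^ (2 * i%:Z - d%:Z - 1)
            - c * cs * q ^ (d%:Z + 1 - 2 * i%:Z)))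
  (hphiE : forall i, (1 <= i <= d)%N ->
     emb (phi i) =
       (q ^+ i - q ^- i)
       * (q ^ (d%:Z - i%:Z + 1) - q ^ (i%:Z - d%:Z - 1))
       * (t - c * bs * q ^ (2 * i%:Z - d%:Z - 1)
            - b * cs * q ^ (d%:Z + 1 - 2 * i%:Z)))
  (zeta : nat -> F) (hzeta : split_seq Phi zeta) :
  let P := normalized_drinfeld d q b c bs cs (fun i => emb (zeta i)) in
  (b * bs * c * cs != 0 ->
   forall psi : K, psi != 0 -> psi + b * bs * c * cs * psi^-1 = t ->
     roots_are P
       [seq psi * q ^ (d%:Z + 1 - 2 * i%:Z)
            + b * bs * c * cs * psi^-1 * q ^ (2 * i%:Z - d%:Z - 1)
       | i : nat <- iota 1 d])
  /\
  (b * bs * c * cs = 0 ->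
     roots_are P [seq t * q ^ (d%:Z + 1 - 2 * i%:Z) | i : nat <- iota 1 d]).
Proof.
move=> P.
have sysPhi := hPhi.1.
(* If q^(2j) = 1 then theta_j = theta_0. *)
have nz j : (1 <= j <= d)%N -> qint q j != 0.
  move=> /andP[j1 le_jd]; apply: contraTneq j1 => /eqP.
  rewrite /qint subr_eq0 => /eqP qj.
  have q2j : q ^ (2 * j%:Z) = 1.
    have -> : 2 * j%:Z = j%:Z + j%:Z by lia.
    by rewrite expfzDr // {1}qj -expfzDr // addNr.
  suff -> : j = 0%N by [].
  apply: (eigenvalue_seq_inj sysPhi htheta) => //.
  apply: (fmorph_inj emb); rewrite !hthetaE //.
  have -> : 2 * 0%:Z - d%:Z = - d%:Z by lia.
  have -> : d%:Z - 2 * 0%:Z = d%:Z by lia.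
  rewrite !expfzDr // q2j mul1r.
  by rewrite -[q ^ - (2 * _)]invr_expz q2j invr1 mulr1.
(* The values u = psi, v = b bs c cs / psi and u = t, v = 0 give the two cases. *)
have main u v : u * v = b * bs * (c * cs) -> u + v = t ->
    roots_are P [seq u * q ^ (d%:Z + 1 - 2 * i%:Z)
                     + v * q ^ (2 * i%:Z - d%:Z - 1) | i : nat <- iota 1 d].
  move=> euv et.
  have [p [p' [r [r' [eu ev ex ey]]]]] := rank_one_factorization euv.
  have C0 : \prod_(1 <= j < d.+1) qint q j ^+ 2 != 0.
    rewrite prodf_seq_neq0; apply/allP => j; rewrite mem_index_iota => hj.
    by rewrite expf_neq0 // nz.
  apply: (roots_are_scale_prod C0).
  rewrite big_map -eu -ev /P (normalized_drinfeldE hq0 nz (esym ex) (esym ey)).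
    by rewrite /index_iota subSS subn0.
  move=> i le_id; rewrite (split_seq_unique sysPhi hzeta hvarphi le_id).
  rewrite rmorph_prod; apply: eq_big_nat => j /andP[j1 ji].
  rewrite hvarphiE; last by rewrite j1; exact: leq_trans le_id.
  rewrite eu ev et /qint exprnN; congr (_ * (q ^ _ - q ^ _) * _); lia.
split=> [_ psi psi0 et|e0]; first by apply: main => //; field.
have := main t 0; rewrite mulr0 addr0 => /(_ _ erefl).
under eq_map do rewrite mul0r addr0.
by apply; rewrite -e0; ring.
Qed.
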